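(* Let $k\ge2$, $p\ge1$ be integers and let $\varphi:\mathbb{Z}_k\to\mathbb{R}$ be even with $\sum_{x\in\mathbb{Z}_k}\varphi(x)=0$. For all fixed angles $\bm\gamma,\bm\beta\in\mathbb{R}^p$ and all $0\le m\le p$, the tensor $H_d^{(m)}$ defined in the context converges entrywise as $d\to\infty$ to a $d$-independent limit $H^{(m)}$, given by the recursion $H^{(0)}\equiv1$ and $$H^{(m+1)}(\bm a)=\exp\Biggl(-\frac12\sum_{\substack{\xi,\eta\in\mathbb{Z}_k\\ t,u\in\mathcal I_p}}G^{(m)}_{(\xi,t),(\eta,u)}\,\Gamma_t\Gamma_u\,\frac{\hat\varphi(\xi)\hat\varphi(\eta)}{k^2}\,\omega^{\xi a_t}\omega^{\eta a_u}\Biggr),\qquad 0\le m<p,$$ where $\omega=e^{2\pi i/k}$ and $$G^{(m)}_{(\xi,t),(\eta,u)}:=\sum_{\bm b\in\mathbb{Z}_k^{\mathcal I_p}}\overline\omega^{\,\xi b_t}\,\overline\omega^{\,\eta b_u}\,f(\bm b)\,H^{(m)}(\bm b).$$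
   Context: $\mathcal I_p=\{1,2,\dots,p,p+1,-p-1,-p,\dots,-2,-1\}$. The discrete Fourier transform is $\hat\varphi(\xi)=\sum_{x\in\mathbb{Z}_k}\varphi(x)\,\overline\omega^{\,\xi x}$. On $\mathbb{C}^k$ with orthonormal basis $\{\ket a\}_{a\in\mathbb{Z}_k}$, $\ket+=k^{-1/2}\sum_a\ket a$. Given $\bm\gamma=(\gamma_1,\dots,\gamma_p)$ and $\bm\beta=(\beta_1,\dots,\beta_p)$, put $\Gamma_t=\gamma_t$ and $\Gamma_{-t}=-\gamma_t$ for $1\le t\le p$, and $\Gamma_{p+1}=\Gamma_{-p-1}=0$. For $\bm c\in\mathbb{Z}_k^{\mathcal I_p}$ let $\Phi(\bm c)=\sum_{t\in\mathcal I_p}\Gamma_t\,\varphi(c_t)$. Define, for $\bm a\in\mathbb{Z}_k^{\mathcal I_p}$, $$f(\bm a)=\frac1k\,\mathbf 1[a_{p+1}=a_{-p-1}]\prod_{1\le t\le p}\bra{a_t}e^{i\beta_t\ket+\bra+}\ket{a_{t+1}}\,\bra{a_{-t-1}}e^{-i\beta_t\ket+\bra+}\ket{a_{-t}},$$ and, for each integer $d\ge1$, $$H_d^{(0)}(\bm a)=1,\qquad H_d^{(m+1)}(\bm a)=\Bigl(\sum_{\bm b\in\mathbb{Z}_k^{\mathcal I_p}}f(\bm b)\,H_d^{(m)}(\bm b)\,e^{i\Phi(\bm a-\bm b)/\sqrt d}\Bigr)^d\quad(0\le m<p).$$ *)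

(* Defs.v *)
From HB Require Import structures.
From mathcomp Require Import all_boot all_order all_algebra.
From mathcomp Require Import complex.
From mathcomp Require Import all_classical all_reals all_analysis.
Set Implicit Arguments. Unset Strict Implicit. Unset Printing Implicit Defensive.
Import Order.TTheory GRing.Theory Num.Theory.
Import numFieldNormedType.Exports.
Local Open Scope classical_set_scope.
Local Open Scope ring_scope.

(* The complex numbers R[i], seen as a numClosedFieldType so that the norm
   topology of numFieldType (and the induced one on matrices) is inferred. *)
Definition CC (R : realType) : numClosedFieldType := R[i].

Definition ofR (R : realType) (x : R) : CC R := x%:C%C.

Definition expC (R : realType) (z : CC R) : CC R :=
  ofR (expR (complex.Re z)) *
  (ofR (cos (complex.Im z)) + 'i * ofR (sin (complex.Im z))).

Definition expmx (R : realType) (n : nat) (A : 'M[CC R]_n.+1) : 'M[CC R]_n.+1 :=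
  limn (series (fun j : nat => (j`!%:R)^-1 *: A ^+ j)).

(* 1 < k is assumed wherever these are used, so that 'Z_k is Z/kZ; its
   carrier is 'I_(Zp_trunc k).+2, which indexes the rows of matrices on C^k. *)
Notation ketT R k := ('cV[CC R]_((Zp_trunc k).+2)).
Notation opT R k := ('M[CC R]_((Zp_trunc k).+2)).

Definition ket (R : realType) (k : nat) (a : 'Z_k) : ketT R k := delta_mx a 0.

Definition ketplus (R : realType) (k : nat) : ketT R k :=
  (sqrtC k%:R)^-1 *: \sum_(a : 'Z_k) ket R a.

Definition bra (R : realType) (n : nat) (v : 'cV[CC R]_n) : 'rV[CC R]_n :=
  (v ^t* )%sesqui.

Definition braket (R : realType) (k : nat) (a : 'Z_k) (A : opT R k)
    (b : 'Z_k) : CC R :=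
  (bra (ket R a) *m A *m ket R b) 0 0.

Definition projplus (R : realType) (k : nat) : opT R k :=
  ketplus R k *m bra (ketplus R k).

(* (true, s) stands for s + 1 and (false, s) for - (s + 1), 0 <= s <= p. *)
Definition Ip (p : nat) : finType := (bool * 'I_p.+1)%type.

Notation config k p := {ffun Ip p -> 'Z_k}.

(* For s : 'I_p, i.e. the time t = s + 1 with 1 <= t <= p, these are the indices
   t, t + 1, - t and - t - 1. *)
Definition it (p : nat) (s : 'I_p) : Ip p := (true, widen_ord (leqnSn p) s).
Definition itS (p : nat) (s : 'I_p) : Ip p := (true, lift ord0 s).
Definition iNt (p : nat) (s : 'I_p) : Ip p := (false, widen_ord (leqnSn p) s).
Definition iNtS (p : nat) (s : 'I_p) : Ip p := (false, lift ord0 s).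

(* unlift ord_max t.2 is None exactly for t = p + 1 and t = - p - 1. *)
Definition Gam (R : realType) (p : nat) (gam : 'rV[R]_p) (t : Ip p) : R :=
  if unlift ord_max t.2 is Some s
  then (if t.1 then gam 0 s else - gam 0 s) else 0.

Definition Phi (R : realType) (k p : nat) (phi : 'Z_k -> R) (gam : 'rV[R]_p)
    (c : config k p) : R :=
  \sum_(t : Ip p) Gam gam t * phi (c t).

Definition fweight (R : realType) (k p : nat) (bet : 'rV[R]_p)
    (a : config k p) : CC R :=
  (k%:R)^-1 * (a (true, ord_max) == a (false, ord_max))%:R *
  \prod_(s < p)
    (braket (a (it s)) (expmx (('i * ofR (bet 0 s)) *: projplus R k)) (a (itS s)) *
     braket (a (iNtS s)) (expmx ((- 'i * ofR (bet 0 s)) *: projplus R k)) (a (iNt s))).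

Fixpoint Hd (R : realType) (k p : nat) (phi : 'Z_k -> R) (gam bet : 'rV[R]_p)
    (d m : nat) (a : config k p) : CC R :=
  if m is m'.+1 then
    (\sum_(b : config k p) fweight bet b * Hd phi gam bet d m' b *
       expC ('i * ofR (Phi phi gam (a - b) / Num.sqrt d%:R))) ^+ d
  else 1.

Definition omega (R : realType) (k : nat) : CC R :=
  expC (2 * ofR pi * 'i / k%:R).

(* Exponents of omega are taken in 'Z_k and coerced to their representative in
   {0, ..., k - 1}. *)
Definition dft (R : realType) (k : nat) (phi : 'Z_k -> R) (xi : 'Z_k) : CC R :=
  \sum_(x : 'Z_k) ofR (phi x) * ((omega R k)^*) ^+ (xi * x)%R.

Definition Gcorr (R : realType) (k p : nat) (bet : 'rV[R]_p)
    (H : config k p -> CC R) (xi : 'Z_k) (t : Ip p) (eta : 'Z_k) (u : Ip p) :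
    CC R :=
  \sum_(b : config k p)
    ((omega R k)^*) ^+ (xi * b t)%R * ((omega R k)^*) ^+ (eta * b u)%R *
    fweight bet b * H b.

Fixpoint Hlim (R : realType) (k p : nat) (phi : 'Z_k -> R)
    (gam bet : 'rV[R]_p) (m : nat) (a : config k p) : CC R :=
  if m is m'.+1 then
    expC (- 2^-1 *
      \sum_(xi : 'Z_k) \sum_(eta : 'Z_k) \sum_(t : Ip p) \sum_(u : Ip p)
        Gcorr bet (Hlim phi gam bet m') xi t eta u *
        ofR (Gam gam t) * ofR (Gam gam u) *
        (dft phi xi * dft phi eta / k%:R ^+ 2) *
        (omega R k) ^+ (xi * a t)%R * (omega R k) ^+ (eta * a u)%R)
  else 1.

(* Main.v *)
(* Write H_d for H_d^{(m)} and f for the weight. Two exact identities hold for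
   every d.  First, sum_b f(b) H_d(b) = 1: a tensor whose value at b does not see
   the times |t| > j as soon as b_t = b_{-t} there can be summed against f one
   pair of times at a time, from p + 1 inwards, because each mixer is unitary;
   H_d has this property by induction, the phases at t and -t cancelling when
   b_t = b_{-t}.  Second, sum_b f(b) H_d(b) Phi(a - b) = 0: f and H_d are
   invariant under translating all entries of b, and phi has mean zero.  So in
   the second-order expansion of e^{i Phi / sqrt d} only the quadratic term
   survives,
     d (sum_b f H_d e^{i Phi(a - b) / sqrt d} - 1) -> - 1/2 sum_b f H Phi(a - b)^2,
   and taking d-th powers gives the exponential of the limit.  Fourier inversion
   of phi rewrites this quadratic form in terms of G. *)

From HB Require Import structures.
Require Import Defs.
From mathcomp Require Import all_boot all_order all_algebra.
From mathcomp Require Import complex.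
From mathcomp Require Import all_classical all_reals all_analysis.
From mathcomp Require Import ring lra.
Import Order.TTheory GRing.Theory Num.Theory.
Import numFieldNormedType.Exports.
Local Open Scope classical_set_scope.
Local Open Scope ring_scope.
Set Implicit Arguments. Unset Strict Implicit. Unset Printing Implicit Defensive.

(** * Real scalars in the complex field and the complex exponential *)

HB.instance Definition _ (R : realType) :=
  GRing.RMorphism.copy (@ofR R) (real_complex R).

Lemma norm_ofR (R : realType) (x : R) : `|ofR x| = ofR `|x|.
Proof. by rewrite /ofR normc_def /= expr0n /= addr0 sqrtr_sqr. Qed.

Lemma ler_ofR (R : realType) (x y : R) : (ofR x <= ofR y) = (x <= y).
Proof. exact: lecR. Qed.

Lemma cvg_ofR (R : realType) (T : Type) (F : set_system T) (FF : Filter F)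
    (u : T -> R) (l : R) :
  u @ F --> l -> (fun x => ofR (u x)) @ F --> ofR l.
Proof.
move=> /cvgrPdist_lt ul; apply/cvgrPdist_lt => e e0.
have eR : ofR (complex.Re e) = e by rewrite /ofR RRe_real // gtr0_real.
(* The order on [CC R] only compares numbers with equal imaginary parts, so a positive [e] is real
   and yields a real tolerance. *)
have e0' : 0 < complex.Re e by move: e0; rewrite -eR ltcR.
apply: filterS (ul _ e0') => x xe.
by rewrite -rmorphB norm_ofR -eR ltcR.
Qed.

Lemma complex_rect (R : realType) (z : CC R) :
  z = ofR (complex.Re z) + 'i * ofR (complex.Im z).
Proof. by rewrite [LHS]complexE complexiE. Qed.

Lemma cRe_rect (R : realType) (x y : R) : complex.Re (ofR x + 'i * ofR y) = x.
Proof.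
by rewrite -complexiE /ofR /= !mul0r mul1r subr0 addr0.
Qed.

Lemma cIm_rect (R : realType) (x y : R) : complex.Im (ofR x + 'i * ofR y) = y.
Proof.
by rewrite -complexiE /ofR /= !mul0r mul1r !add0r.
Qed.

Lemma expC_rect (R : realType) (x y : R) :
  expC (ofR x + 'i * ofR y) =
  ofR (expR x) * (ofR (cos y) + 'i * ofR (sin y)).
Proof. by rewrite /expC cRe_rect cIm_rect. Qed.

Lemma expCi (R : realType) (y : R) :
  expC ('i * ofR y) = ofR (cos y) + 'i * ofR (sin y).
Proof.
rewrite -[in LHS](add0r ('i * _)) -(rmorph0 (@ofR R)) expC_rect.
by rewrite expR0 rmorph1 mul1r.
Qed.

Lemma expC0 (R : realType) : expC 0 = 1 :> CC R.
Proof.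
rewrite -(mulr0 'i) -(rmorph0 (@ofR R)) expCi.
by rewrite cos0 sin0 rmorph0 mulr0 addr0 rmorph1.
Qed.

Lemma expCD (R : realType) (z w : CC R) : expC (z + w) = expC z * expC w.
Proof.
rewrite (complex_rect z) (complex_rect w) addrACA -mulrDr -!rmorphD !expC_rect.
rewrite expRD cosD sinD !(rmorphD, rmorphB, rmorphM) /=.
have i2 : 'i * 'i = -1 :> CC R by rewrite -expr2 sqrCi.
set i := 'i in i2 *; ring: i2.
Qed.

Lemma expCMn (R : realType) (z : CC R) (n : nat) :
  expC (z *+ n) = expC z ^+ n.
Proof. by elim: n => [|n IH]; rewrite ?expC0 // mulrS exprS expCD IH. Qed.

Lemma norm_rect (R : realType) (z : CC R) :
  `|z| = ofR (Num.sqrt (complex.Re z ^+ 2 + complex.Im z ^+ 2)).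
Proof. exact: (normc_def (z : R[i])). Qed.

Lemma norm_expC (R : realType) (z : CC R) :
  `|expC z| = ofR (expR (complex.Re z)).
Proof.
rewrite /expC normrM norm_ofR (ger0_norm (expR_ge0 _)).
rewrite -[RHS]mulr1; congr (_ * _).
by rewrite norm_rect cRe_rect cIm_rect cos2Dsin2 sqrtr1 rmorph1.
Qed.

(** * First- and second-order limits of the real and complex exponentials *)

(* The difference quotient of f extended by l at 0 is continuous there, so no
   term of the null sequence u has to be nonzero. *)
Lemma cvg_scaled_increment (R : realType) (f : R -> R) (l c : R)
    (a u : nat -> R) :
  is_derive (0 : R) 1 f l -> u @ \oo --> 0 -> (fun n => a n * u n) @ \oo --> c ->
  (fun n => a n * (f (u n) - f 0)) @ \oo --> l * c.
Proof.
move=> [df dfl] u0 auc.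
pose g h := if h == 0 then l else h^-1 * (f h - f 0).
have g0 : g h @[h --> 0] --> g 0.
  apply/continuous_withinNx; rewrite {2}/g eqxx.
  rewrite -dfl; move: df; rewrite /derivable -/('D_1 f 0) => /cvg_ex[l' dl'].
  have -> : 'D_1 f 0 = l' by apply: cvg_lim.
  apply: cvg_trans dl'; apply: near_eq_cvg; near=> h.
  rewrite /g ifF; last by apply/negbTE; near: h; exact: nbhs_dnbhs_neq.
  by rewrite /= addr0 [_%:A]mulr1.
have gu : (g \o u) @ \oo --> l.
  have := cvg_comp u g u0 g0; rewrite {2}/g eqxx; exact.
have -> : (fun n => a n * (f (u n) - f 0)) = (g \o u) \* (fun n => a n * u n).
  apply/funext => n /=; rewrite /g; case: eqP => [->|/eqP un0].
    by rewrite subrr !mulr0.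
  by field.
exact: cvgM.
Unshelve. all: by end_near.
Qed.

Lemma cvg_nVn (R : realType) (x : R) :
  (fun n : nat => n%:R * (x / n%:R)) @ \oo --> x.
Proof.
apply: cvg_near_cst; near=> n.
by rewrite mulrC divfK // pnatr_eq0 -lt0n; near: n; exact: nbhs_infty_gt.
Unshelve. all: by end_near.
Qed.

Lemma cvg_Vn (R : realType) (x : R) : (fun n : nat => x / n%:R) @ \oo --> 0.
Proof.
rewrite -[X in _ --> X](mulr0 x); apply: cvgM; first exact: cvg_cst.
apply/gtr0_cvgV0; first by near=> n; rewrite ltr0n; near: n; exact: nbhs_infty_gt.
apply/cvgrnyP; exact: cvg_id.
Unshelve. all: by end_near.
Qed.

Lemma cvg_Vsqrt (R : realType) (x : R) :
  (fun n : nat => x / Num.sqrt n%:R) @ \oo --> 0.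
Proof.
rewrite -[X in _ --> X](mulr0 x); apply: cvgM; first exact: cvg_cst.
have -> : (fun n : nat => (Num.sqrt n%:R)^-1) = Num.sqrt \o (fun n => 1 / n%:R) :> (nat -> R).
  by apply/funext => n /=; rewrite div1r sqrtrV.
rewrite -sqrtr0; apply: cvg_comp; [exact: cvg_Vn|exact: sqrt_continuous].
Qed.

Lemma cvg_sqrtVsqrt (R : realType) (x : R) :
  (fun n : nat => Num.sqrt n%:R * (x / Num.sqrt n%:R)) @ \oo --> x.
Proof.
apply: cvg_near_cst; near=> n.
rewrite mulrC divfK // sqrtr_eq0 -ltNge ltr0n; near: n; exact: nbhs_infty_gt.
Unshelve. all: by end_near.
Qed.

Lemma le_norm_sin (R : realType) (x : R) : `|sin x| <= `|x|.
Proof.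
wlog x0 : x / 0 <= x.
  move=> H; have [/H//|/ltW] := leP 0 x.
  by rewrite -oppr_ge0 => /H; rewrite sinN !normrN.
have ds y : y \in `]0, x[ -> is_derive y 1 (@sin R) (cos y).
  by move=> _; exact: is_derive_sin.
have cs : {within `[0, x], continuous (@sin R)}.
  by apply: continuous_subspaceT => y; exact: continuous_sin.
have [c _] := MVT_segment x0 ds cs.
rewrite sin0 !subr0 => ->; rewrite normrM -[leRHS]mul1r.
by apply: ler_wpM2r => //; exact: cos_max.
Qed.

Lemma one_sub_cos (R : realType) (x : R) : 1 - cos x = 2 * sin (x / 2) ^+ 2.
Proof.
have {1}-> : x = (x / 2) *+ 2 by rewrite -mulr_natr divfK.
by rewrite cos_mulr2n cos2sin2; ring.
Qed.

(** Mean value theorem: the derivative [cos c - 1] is [- 2 * sin (c / 2) ^+ 2], of size at most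
    [x ^+ 2 / 2]. The crude constant 1 is enough, only the cubic order being used. *)
Lemma sin_sub_le (R : realType) (x : R) : `|sin x - x| <= `|x| ^+ 3.
Proof.
wlog x0 : x / 0 <= x.
  move=> H; have [/H//|/ltW] := leP 0 x.
  by rewrite -oppr_ge0 => /H; rewrite sinN -opprD !normrN.
have ds y : y \in `]0, x[ -> is_derive y 1 (fun y => sin y - y) (cos y - 1).
  by move=> _; apply: is_deriveB.
have cs : {within `[0, x], continuous (fun y : R => sin y - y)}.
  by apply: continuous_subspaceT => y; apply: cvgB; [exact: continuous_sin|exact: cvg_id].
have [c] := MVT_segment x0 ds cs.
rewrite in_itv /= => /andP[c0 cx]; rewrite sin0 !subr0 => ->.
rewrite normrM distrC one_sub_cos (exprSr `|x|) ler_wpM2r // ger0_norm; last first.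
  by rewrite mulr_ge0 // sqr_ge0.
rewrite -[sin _ ^+ 2]ger0_norm ?sqr_ge0 // normrX.
have h : `|sin (c / 2)| ^+ 2 <= (x / 2) ^+ 2.
  rewrite lerXn2r ?nnegrE // ?divr_ge0 //.
  rewrite (le_trans (le_norm_sin _)) // ger0_norm ?divr_ge0 //.
  by rewrite ler_wpM2r.
have x2 : 0 <= x ^+ 2 by rewrite sqr_ge0.
rewrite (ger0_norm x0); move: h; rewrite expr_div_n; lra.
Qed.

(** By the half-angle formula this second-order limit is -2 times the square of a first-order limit
    for the sine at scale [Num.sqrt n%:R]. *)
Lemma cvg_cos_increment (R : realType) (y : R) :
  (fun n : nat => n%:R * (cos (y / Num.sqrt n%:R) - 1)) @ \oo --> - 2^-1 * y ^+ 2.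
Proof.
pose s n := Num.sqrt n%:R * (sin (y / 2 / Num.sqrt n%:R) - sin 0).
have -> : (fun n : nat => n%:R * (cos (y / Num.sqrt n%:R) - 1)) =
    (fun n => - 2 * (s n * s n)).
  apply/funext => n; rewrite /s sin0 subr0 -opprB one_sub_cos.
  rewrite (mulrAC y); set q := sin _.
  by rewrite -[n%:R in LHS]sqr_sqrtr ?ler0n //; ring.
have s1 : s @ \oo --> cos 0 * (y / 2).
  apply: (@cvg_scaled_increment _ sin); [exact: cvg_Vsqrt|].
  exact: cvg_sqrtVsqrt.
rewrite cos0 mul1r in s1.
have -> : - 2^-1 * y ^+ 2 = - 2 * (y / 2 * (y / 2)) :> R by field.
by apply: cvgM; [exact: cvg_cst|exact: cvgM].
Qed.

Lemma cvg_sin_remainder (R : realType) (y : R) :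
  (fun n : nat => n%:R * (sin (y / Num.sqrt n%:R) - y / Num.sqrt n%:R)) @ \oo --> 0.
Proof.
apply/norm_cvg0P; pose b n : R := `|y| ^+ 2 * (`|y| / Num.sqrt n%:R).
apply: (@squeeze_cvgr _ _ _ _ (fun=> 0) b); last 2 first.
- exact: cvg_cst.
- rewrite -[X in _ --> X](mulr0 (`|y| ^+ 2)); apply: cvgM; first exact: cvg_cst.
  exact: cvg_Vsqrt.
near=> n; rewrite normr_ge0 /= normrM normr_nat /b.
have s0 : 0 < Num.sqrt n%:R :> R.
  by rewrite sqrtr_gt0 ltr0n; near: n; exact: nbhs_infty_gt.
rewrite -[n%:R in X in X * _]sqr_sqrtr ?ler0n //.
apply: le_trans (ler_wpM2l (sqr_ge0 _) (sin_sub_le _)) _.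
rewrite normrM normfV (ger0_norm (ltW s0)).
suff -> : Num.sqrt n%:R ^+ 2 * (`|y| / Num.sqrt n%:R) ^+ 3 =
  `|y| ^+ 2 * (`|y| / Num.sqrt n%:R) by [].
by field; rewrite gt_eqF.
Unshelve. all: by end_near.
Qed.

(** The cosine supplies the quadratic term; the sine minus its linear part is cubic in
    [y / Num.sqrt n%:R] and vanishes even after multiplication by n. *)
Lemma cvg_expCi_remainder (R : realType) (y : R) :
  (fun n : nat => n%:R * (expC ('i * ofR (y / Num.sqrt n%:R)) - 1
     - 'i * ofR (y / Num.sqrt n%:R))) @ \oo --> ofR (- 2^-1 * y ^+ 2).
Proof.
have -> : (fun n : nat => n%:R * (expC ('i * ofR (y / Num.sqrt n%:R)) - 1
     - 'i * ofR (y / Num.sqrt n%:R))) = (fun n : nat =>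
   ofR (n%:R * (cos (y / Num.sqrt n%:R) - 1)) + 'i *
   ofR (n%:R * (sin (y / Num.sqrt n%:R) - y / Num.sqrt n%:R))).
  apply/funext => n; rewrite expCi; set v := y / _.
  by rewrite ![ofR (_%:R * _)]rmorphM !rmorphB !rmorph_nat rmorph1 /=; ring.
rewrite -[X in _ --> X]addr0 -[X in _ + X](mulr0 'i) -(rmorph0 (@ofR R)).
apply: cvgD; first by apply: cvg_ofR; exact: cvg_cos_increment.
apply: cvgM; first exact: cvg_cst.
by apply: cvg_ofR; exact: cvg_sin_remainder.
Qed.

Lemma cvg_expC_increment (R : realType) (z : CC R) :
  (fun n : nat => n%:R * (expC (z / n%:R) - 1)) @ \oo --> z.
Proof.
set x := complex.Re z; set y := complex.Im z.
(* The real part uses e^s cos t - 1 = (e^s - 1) cos t + (cos t - 1), so that every factor is a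
   one-variable increment at 0. *)
have -> : (fun n : nat => n%:R * (expC (z / n%:R) - 1)) = (fun n : nat =>
   ofR (n%:R * (expR (x / n%:R) - expR 0) * cos (y / n%:R)
        + n%:R * (cos (y / n%:R) - cos 0)) + 'i *
   ofR (expR (x / n%:R) * (n%:R * (sin (y / n%:R) - sin 0)))).
  apply/funext => n; rewrite [z in LHS]complex_rect -/x -/y.
  have -> : (ofR x + 'i * ofR y) / n%:R = ofR (x / n%:R) + 'i * ofR (y / n%:R).
    by rewrite !fmorph_div !rmorph_nat mulrDl mulrA.
  rewrite expC_rect expR0 cos0 sin0 subr0.
  by rewrite !(rmorphM, rmorphD, rmorphB, rmorph1) /= !rmorph_nat; ring.
rewrite [X in _ --> X]complex_rect -/x -/y.
have xe : (fun n : nat => n%:R * (expR (x / n%:R) - expR 0)) @ \oo --> expR 0 * x.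
  by apply: (@cvg_scaled_increment _ expR); [exact: cvg_Vn|exact: cvg_nVn].
have yc : (fun n : nat => n%:R * (cos (y / n%:R) - cos 0)) @ \oo --> - sin 0 * y.
  by apply: (@cvg_scaled_increment _ cos); [exact: cvg_Vn|exact: cvg_nVn].
have ys : (fun n : nat => n%:R * (sin (y / n%:R) - sin 0)) @ \oo --> cos 0 * y.
  by apply: (@cvg_scaled_increment _ sin); [exact: cvg_Vn|exact: cvg_nVn].
have c1 : (fun n : nat => cos (y / n%:R)) @ \oo --> cos 0.
  exact: (cvg_comp (fun n : nat => y / n%:R) cos (cvg_Vn y) (@continuous_cos R 0)).
have e1 : (fun n : nat => expR (x / n%:R)) @ \oo --> expR 0.
  exact: (cvg_comp (fun n : nat => x / n%:R) expR (cvg_Vn x) (@continuous_expR R 0)).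
apply: cvgD.
  apply: cvg_ofR.
  have {2}-> : x = expR 0 * x * cos 0 + - sin 0 * y.
    by rewrite cos0 sin0 expR0 mul1r mulr1 oppr0 mul0r addr0.
  by apply: cvgD => //; exact: cvgM.
apply: cvgM; first exact: cvg_cst.
apply: cvg_ofR; have {2}-> : y = expR 0 * (cos 0 * y) by rewrite cos0 expR0 !mul1r.
exact: cvgM.
Qed.

(** * Limits of n-th powers *)

(** Factor x^n - y^n as (x - y) times n monomials of degree n - 1, each bounded by a power of M; for
    n = 0 both sides are 0. *)
Lemma le_norm_subX (F : numFieldType) (x y M : F) (n : nat) :
  `|x| <= M -> `|y| <= M -> `|x ^+ n - y ^+ n| <= `|x - y| * (M ^+ n.-1 *+ n).
Proof.
move=> xM yM; rewrite subrXX normrM ler_wpM2l //.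
apply: le_trans (ler_norm_sum _ _ _) _.
have <- : \sum_(i < n) M ^+ n.-1 = M ^+ n.-1 *+ n by rewrite sumr_const card_ord.
apply: ler_sum => i _.
have M0 : 0 <= M by apply: le_trans xM.
rewrite normrM !normrX.
have -> : M ^+ n.-1 = M ^+ (n.-1 - i) * M ^+ i.
  by rewrite -exprD subnK //; case: n i => [[]//|n i]; rewrite -ltnS.
by apply: ler_pM; rewrite ?exprn_ge0 // lerXn2r ?nnegrE.
Qed.

(* Compares w n ^+ n with expC (z / n) ^+ n = expC z, both bases being bounded
   by expR (K / n). *)
Lemma cvg_exprn_expC (R : realType) (w : nat -> CC R) (z : CC R) :
  (fun n : nat => n%:R * (w n - 1)) @ \oo --> z ->
  (fun n : nat => w n ^+ n) @ \oo --> expC z.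
Proof.
move=> wz; pose v n := expC (z / n%:R).
(* The margin 1 over [|z|] makes [|n%:R * (w n - 1)|] eventually at most [K]. *)
pose K : R := complex.Re `|z| + 1.
have zK : ofR K = `|z| + 1.
  by rewrite rmorphD rmorph1 /=; congr (_ + _); exact: RRe_real.
pose M n : CC R := ofR (expR (K / n%:R)).
have vX n : (0 < n)%N -> v n ^+ n = expC z.
  by move=> n0; rewrite -expCMn -[_ *+ n]mulr_natr divfK // pnatr_eq0 -lt0n.
have ReK : complex.Re z <= K.
  rewrite -ler_ofR zK (@le_trans _ _ `|z|) ?lerDl //.
  apply: le_trans (normc_ge_Re z); rewrite lecR; exact: ler_norm.
have bnd : \forall n \near \oo, `|v n ^+ n - w n ^+ n| <=
    ofR (expR K) * `|n%:R * (v n - 1) - n%:R * (w n - 1)|.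
  have : \forall n \near \oo, `|n%:R * (w n - 1)| <= ofR K.
    have nz : (fun n => `|n%:R * (w n - 1)|) @ \oo --> `|z| by exact: cvg_norm.
    move/cvgrPdist_lt : nz => /(_ 1 ltr01); apply: filterS => n.
    rewrite zK => h; rewrite -lerBlDl.
    apply: le_trans (ltW h); rewrite distrC; apply: real_ler_norm.
    by rewrite realB ?normr_real.
  move=> wK; near=> n.
  have n0 : (0 < n)%N by near: n; exact: nbhs_infty_gt.
  have nR : 0 < n%:R :> R by rewrite ltr0n.
  have nC : (n%:R : CC R) != 0 by rewrite pnatr_eq0 -lt0n.
  have vM : `|v n| <= M n.
    rewrite norm_expC ler_ofR ler_expR.
    have -> : z / n%:R = ofR (complex.Re z / n%:R) + 'i * ofR (complex.Im z / n%:R).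
      by rewrite {1}(complex_rect z) !fmorph_div !rmorph_nat mulrDl mulrA.
    by rewrite cRe_rect ler_pM2r ?invr_gt0.
  (* Here |w| <= 1 + K/n <= e^(K/n). *)
  have wM : `|w n| <= M n.
    have -> : w n = 1 + (n%:R * (w n - 1)) / n%:R.
      by rewrite mulrC mulKf // addrC subrK.
    apply: le_trans (ler_normD _ _) _; rewrite normr1.
    have : `|n%:R * (w n - 1) / n%:R| <= ofR (K / n%:R).
      rewrite normrM normfV normr_nat fmorph_div rmorph_nat.
      by rewrite ler_wpM2r ?invr_ge0 ?ler0n //; near: n.
    move=> h; apply: le_trans (_ : 1 + ofR (K / n%:R) <= _); first by rewrite lerD2l.
    by rewrite -(rmorph1 (@ofR R)) -rmorphD ler_ofR expR_ge1Dx.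
  apply: le_trans (le_norm_subX n vM wM) _.
  rewrite -mulrBr opprB addrA subrK normrM normr_nat mulrC.
  rewrite -[_ *+ n]mulr_natr -mulrA ler_wpM2r ?mulr_ge0 ?ler0n //.
  (* [M n ^+ n.-1] is the exponential of K (n - 1) / n, hence at most e^K. *)
  rewrite /M -rmorphXn ler_ofR -expRM_natl ler_expR.
  have K0 : 0 <= K by rewrite -ler_ofR zK addr_ge0.
  rewrite mulrCA -[leRHS]mulr1 ler_wpM2l // ler_pdivrMr // mul1r ler_nat.
  exact: leq_pred.
have d0 : (fun n => w n ^+ n - v n ^+ n) @ \oo --> 0.
  have lim0 : (fun n : nat => ofR (expR K) *
      `|n%:R * (v n - 1) - n%:R * (w n - 1)|) @ \oo --> 0.
    rewrite -[X in _ --> X](mulr0 (ofR (expR K))); apply: cvgM; first exact: cvg_cst.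
    rewrite -[X in _ --> X](@normr0 _ (CC R)) -(subrr z); apply: cvg_norm.
    by apply: cvgB => //; exact: cvg_expC_increment.
  apply/cvgrPdist_lt => e e0; move/cvgrPdist_lt : lim0 => /(_ e e0) bnde.
  apply: filterS2 bnd bnde => n; rewrite distrC => vw; rewrite !sub0r !normrN.
  apply: le_lt_trans; apply: (le_trans vw); rewrite real_ler_norm // realM //.
  by rewrite ger0_real // ler0c expR_ge0.
have vz : (fun n => v n ^+ n) @ \oo --> expC z.
  apply: cvg_near_cst; near=> n; apply: vX.
  by near: n; exact: nbhs_infty_gt.
move: d0 vz; move: (expC z) => l; clearbody v => d0 vz; exact: (cvg_sub0 d0 vz).
Unshelve. all: by end_near.
Qed.

(** * The matrix exponential of a projector and the mixer entries *)

Lemma expi_term (R : realType) (x : R) (j : nat) :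
  (j`!%:R)^-1 * ('i * ofR x) ^+ j =
  ofR (cos_coeff x j) + 'i * ofR (sin_coeff x j).
Proof.
have iX n : 'i ^+ n.*2 = ofR ((-1) ^+ n).
  by rewrite -mul2n exprM sqrCi rmorphXn rmorphN rmorph1.
rewrite exprMn -rmorphXn /= /cos_coeff /sin_coeff /= -exprnP !fmorph_div.
rewrite !rmorphM /= !rmorph_nat.
(* Only the parity of [j] decides between a real and an imaginary term, matching the parity factors
   inside [cos_coeff] and [sin_coeff]. *)
have -> : 'i ^+ j = 'i ^+ odd j * ofR ((-1) ^+ j./2) :> CC R.
  by rewrite -iX -exprD odd_double_half.
case: (boolP (odd j)) => jo /=.
  have -> : j.-1./2 = j./2 by rewrite -{1}(odd_double_half j) jo add1n /= doubleK.
  by ring.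
by ring.
Qed.

Lemma cvg_expi_series (R : realType) (x : R) :
  series (fun j : nat => (j`!%:R)^-1 * ('i * ofR x) ^+ j) @ \oo -->
  expC ('i * ofR x).
Proof.
have -> : series (fun j : nat => (j`!%:R)^-1 * ('i * ofR x) ^+ j) =
    (fun n => ofR (series (cos_coeff x) n) + 'i * ofR (series (sin_coeff x) n)).
  apply/funext => n; rewrite /series /= !rmorph_sum mulr_sumr -big_split /=.
  by apply: eq_bigr => j _; exact: expi_term.
rewrite expCi; apply: cvgD.
  by apply: cvg_ofR; rewrite unlock; exact: is_cvg_series_cos_coeff.
apply: cvgM; first exact: cvg_cst.
by apply: cvg_ofR; rewrite unlock; exact: is_cvg_series_sin_coeff.
Qed.

Lemma series_ltn (V : zmodType) (u : nat -> V) (n : nat) : (0 < n)%N ->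
  series u n = u 0%N + \sum_(1 <= j < n) u j.
Proof. by move=> n0; rewrite /series /= big_ltn. Qed.

(** All positive powers of [P] equal [P], so beyond the identity term the matrix series is the
    scalar one, less its constant term, times [P]. *)
Lemma expmx_proj (R : realType) (n : nat) (P : 'M[CC R]_n.+1) (x : R) :
  P *m P = P ->
  expmx (('i * ofR x) *: P) = 1 + (expC ('i * ofR x) - 1) *: P.
Proof.
move=> PP; set z := 'i * ofR x.
have PX j : P ^+ j.+1 = P.
  by elim: j => // j IH; rewrite exprS IH.
apply: cvg_lim; first exact: norm_hausdorff.
have c1 : (fun m : nat => series (fun j : nat => (j`!%:R)^-1 * z ^+ j) m - 1) @ \oo -->
    expC z - 1.
  exact: (cvgB (@cvg_expi_series R x) (cvg_cst (1 : CC R))).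
have lim : (fun m : nat => 1 + (series (fun j : nat => (j`!%:R)^-1 * z ^+ j) m - 1) *: P)
    @ \oo --> 1 + (expC z - 1) *: P.
  apply: cvgD; first exact: cvg_cst.
  exact: cvgZr_tmp c1.
apply: cvg_trans lim.
(* The two sequences agree only for m > 0: the empty partial sum lacks the identity term. *)
apply: near_eq_cvg; near=> m.
have m0 : (0 < m)%N by near: m; exact: nbhs_infty_gt.
rewrite !(series_ltn _ m0) fact0 invr1 !expr0 mul1r scale1r.
rewrite [1 + _ - 1]addrAC subrr add0r scaler_suml; congr (_ + _).
by apply: eq_big_nat => -[//|j] _; rewrite exprZn PX scalerA.
Unshelve. all: by end_near.
Qed.

Lemma projplusE (R : realType) (k : nat) :
  projplus R k = const_mx (k%:R^-1).
Proof.
have kpE (a : 'Z_k) : ketplus R k a 0 = (sqrtC k%:R)^-1.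
  rewrite /ketplus mxE summxE (bigD1 a) //= big1 => [|b ba].
    by rewrite !mxE !eqxx addr0 mulr1.
  by rewrite !mxE eq_sym (negbTE ba).
rewrite /projplus /bra; move: (ketplus R k) kpE => K kpE.
apply/matrixP => a b; rewrite !mxE big_ord1 !mxE !kpE.
rewrite fmorphV /= conj_Creal ?ger0_real ?sqrtC_ge0 ?ler0n //.
by rewrite -invfM -expr2 sqrtCK.
Qed.

Lemma card_Zk (k : nat) : (1 < k)%N -> #|{: 'Z_k}| = k.
Proof. by move=> k1; rewrite card_ord Zp_cast. Qed.

Lemma projplus_idem (R : realType) (k : nat) : (1 < k)%N ->
  projplus R k *m projplus R k = projplus R k.
Proof.
move=> k1; rewrite projplusE; apply/matrixP => a b; rewrite !mxE.
under eq_bigr do rewrite !mxE.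
rewrite sumr_const card_Zk //.
by rewrite -(mulr_natr (_ * _)) mulfVK // pnatr_eq0 -lt0n ltnW.
Qed.

(* The matrix entries of exp(i x |+><+|) *)
Definition mixer (R : realType) (k : nat) (x : R) (c : 'Z_k) : CC R :=
  (c == 0)%:R + (expC ('i * ofR x) - 1) / k%:R.

Lemma braket_expmx (R : realType) (k : nat) (x : R) (a b : 'Z_k) : (1 < k)%N ->
  braket a (expmx (('i * ofR x) *: projplus R k)) b = mixer x (a - b).
Proof.
move=> k1; rewrite expmx_proj ?projplus_idem // projplusE.
have bkE (A : 'M[CC R]_((Zp_trunc k).+2)) : braket a A b = A a b.
  rewrite /braket -mulmxA -colE mxE (bigD1 a) //= big1 => [|c ca].
    by rewrite !mxE !eqxx conjC1 mul1r addr0.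
  by rewrite !mxE (negbTE ca) /= conjC0 mul0r.
by rewrite bkE /mixer !mxE subr_eq0.
Qed.

Lemma mixer_unitary (R : realType) (k : nat) (x : R) (a b : 'Z_k) : (1 < k)%N ->
  \sum_(c : 'Z_k) mixer x (a - c) * mixer (- x) (c - b) = (a == b)%:R :> CC R.
Proof.
move=> k1.
pose u : CC R := (expC ('i * ofR x) - 1) / k%:R.
pose v : CC R := (expC ('i * ofR (- x)) - 1) / k%:R.
have k0 : k%:R != 0 :> CC R by rewrite pnatr_eq0 -lt0n ltnW.
(* This is (1 + k u)(1 + k v) = 1, that is e^(ix) e^(-ix) = 1, expanded and divided by k. *)
have uv : u + v + u * v * k%:R = 0.
  have : expC ('i * ofR x) * expC ('i * ofR (- x)) = 1 :> CC R.
    by rewrite -expCD -mulrDr -rmorphD subrr rmorph0 mulr0 expC0.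
  by rewrite /u /v => e; field: e.
have sum1 (d : 'Z_k) (F : 'Z_k -> CC R) : \sum_(c : 'Z_k) (c == d)%:R * F c = F d.
  by rewrite (bigD1 d) //= eqxx mul1r big1 ?addr0 // => c /negbTE ->; rewrite mul0r.
under eq_bigr do rewrite /mixer -/u -/v mulrDl !mulrDr !subr_eq0 (eq_sym a) [u * _]mulrC.
rewrite !big_split /= (sum1 a (fun c => (c == b)%:R)) (sum1 a (fun=> v)).
rewrite (sum1 b (fun=> u)) sumr_const card_Zk // -(mulr_natr (_ * _)).
rewrite -[RHS]addr0 -uv; ring.
Qed.

(** * Truncated configurations and summation from the outermost pair inwards *)

(* Sets to 0 the entries of a configuration at the times t with |t| > j. *)
Definition trunc (k p j : nat) (b : config k p) : config k p :=
  [ffun t : Ip p => if (t.2 < j)%N then b t else 0].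

(** The index r stands for the times r + 1 and - (r + 1), so [j <= r] means |t| > j. *)
Definition mirror (k p j : nat) (b : config k p) : Prop :=
  forall r : 'I_p.+1, (j <= r)%N -> b (true, r) = b (false, r).

Definition tail_trivial (T : Type) (k p j : nat) (W : config k p -> T) : Prop :=
  forall b, mirror j b -> W b = W (trunc j b).

Lemma truncB (k p j : nat) (a b : config k p) :
  trunc j (a - b) = trunc j a - trunc j b.
Proof. by apply/ffunP => t; rewrite !ffunE; case: ifP; rewrite ?subr0. Qed.

Lemma trunc_id (k p j : nat) (b : config k p) : (p < j)%N -> trunc j b = b.
Proof.
move=> pj; apply/ffunP => t; rewrite ffunE.
by rewrite (leq_trans (ltn_ord t.2) pj).
Qed.

Lemma trunc_trunc (k p i j : nat) (b : config k p) : (i <= j)%N ->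
  trunc i (trunc j b) = trunc i b.
Proof.
move=> ij; apply/ffunP => t; rewrite !ffunE; case: ifP => // ti.
by rewrite (leq_trans ti ij).
Qed.

Lemma mirror_fix (k p i j : nat) (b : config k p) : (i <= j)%N ->
  trunc i b = b -> mirror j b.
Proof.
move=> ij <- r jr; rewrite !ffunE /=.
by rewrite ltnNge (leq_trans ij jr).
Qed.

Lemma mirror_le (k p i j : nat) (b : config k p) : (i <= j)%N ->
  mirror i b -> mirror j b.
Proof. by move=> ij bi r jr; apply: bi; exact: leq_trans ij jr. Qed.

Lemma mirrorB (k p j : nat) (a b : config k p) :
  mirror j a -> mirror j b -> mirror j (a - b).
Proof. by move=> aj bj r jr; rewrite !ffunE aj // bj. Qed.

(* The weight of the j earliest pairs of times, closed up at the j-th pair and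
   supported on configurations vanishing beyond it. *)
Definition path_weight (R : realType) (k p : nat)
    (U V : nat -> 'Z_k -> 'Z_k -> CC R) (j : nat) (b : config k p) : CC R :=
  (trunc j b == b)%:R *
  (if j is i.+1 then k%:R^-1 * (b (true, inord i) == b (false, inord i))%:R
   else 1) *
  \prod_(0 <= n < j.-1) (U n (b (true, inord n)) (b (true, inord n.+1)) *
                         V n (b (false, inord n.+1)) (b (false, inord n))).

Section PathSum.
Variables (R : realType) (k p : nat) (U V : nat -> 'Z_k -> 'Z_k -> CC R).
Hypothesis k1 : (1 < k)%N.
Hypothesis UV : forall n a b, \sum_(c : 'Z_k) U n a c * V n c b = (a == b)%:R.

Let put (c : config k p) (j : nat) (x : 'Z_k) : config k p :=
  [ffun t : Ip p => if t.2 == j :> nat then x else c t].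

(** Only the [b] that extend [c] by one common value x at both times of the next pair contribute.
    For j > 0, [UV] turns the sum over x into the closing delta one pair earlier; for j = 0, the k
    values of x cancel the factor 1/k. *)
Lemma path_weight_fiber (j : nat) (c : config k p) : (j <= p)%N ->
  \sum_(b | trunc j b == c) path_weight U V j.+1 b = path_weight U V j c.
Proof.
move=> jp.
have [cE|cN] := eqVneq (trunc j c) c; last first.
  rewrite big1; first by rewrite /path_weight (negbTE cN) !mul0r.
  by move=> b /eqP bc; move: cN; rewrite -bc trunc_trunc // eqxx.
have ordj : (inord j : 'I_p.+1) = j :> nat by rewrite inordK.
have c0 e (r : 'I_p.+1) : (j <= r)%N -> c (e, r) = 0.
  by move=> jr; rewrite -cE ffunE /= ltnNge jr.
have putP x : trunc j (put c j x) = c.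
  apply/ffunP => -[e r]; rewrite !ffunE /=; case: ltnP => jr; last by rewrite c0.
  by rewrite ltn_eqF.
have putT x : trunc j.+1 (put c j x) = put c j x.
  apply/ffunP => -[e r]; rewrite !ffunE /= ltnS; case: leqP => // jr.
  by rewrite gtn_eqF // c0 // ltnW.
have putj e x : put c j x (e, inord j) = x by rewrite ffunE /= ordj eqxx.
have putlt e x n : (n < j)%N -> put c j x (e, inord n) = c (e, inord n).
  move=> nj; rewrite ffunE /= inordK ?ltn_eqF //.
  by rewrite ltnS (leq_trans (ltnW nj) jp).
(* Separate the extensions [put c j x], reindexed by x, from all other [b], whose weights vanish. *)
rewrite (bigID (fun b : config k p => b == put c j (b (true, inord j)))) /= addrC big1 ?add0r.
  rewrite (reindex_onto (put c j) (fun b : config k p => b (true, inord j))) /=;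
    last by move=> b /andP[_ /eqP <-].
  rewrite (eq_bigl xpredT) => [|x]; last by rewrite putP putj !eqxx.
  rewrite /path_weight cE eqxx mul1r.
  case: j jp ordj {cE c0 putP} putT putj putlt => [|j] jp ordj putT putj putlt /=.
    under eq_bigr => x _ do rewrite putT !putj !eqxx big_geq // mul1r !mulr1.
    rewrite big_geq // sumr_const card_Zk // -(mulr_natr k%:R^-1) mulVf ?mulr1 //.
    by rewrite pnatr_eq0 -lt0n ltnW.
  under eq_bigr => x _ do rewrite putT !putj !eqxx mul1r mulr1 big_nat_recr //=
    !putj !putlt // mulrA.
  set D := \prod_(0 <= n < j) _.
  under eq_bigr => x _.
    rewrite (eq_big_nat _ _ (F2 := fun n => U n (c (true, inord n)) (c (true, inord n.+1)) *
       V n (c (false, inord n.+1)) (c (false, inord n)))) => [|n /andP[_ nj]]; last first.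
      by rewrite !putlt // ltnW.
    over.
  by rewrite -mulr_sumr UV mulrAC.
(* A truncated and closed [b] over [c] would be of the form [put c j x], so one of the two
   indicators is 0. *)
move=> b /andP[/eqP bc bN]; rewrite /path_weight.
have [bT|] := eqVneq (trunc j.+1 b) b; last by rewrite !mul0r.
have [bj|] := eqVneq (b (true, inord j)) (b (false, inord j)); last first.
  by rewrite mulr0 mulr0 mul0r.
case/negP: bN; apply/eqP/ffunP => -[e r]; rewrite ffunE /=.
case: eqP => [rj|/eqP rj].
  have -> : r = inord j by apply: val_inj; rewrite /= ordj.
  by case: e.
rewrite -bc ffunE /=; case: ltnP => // jr.
by rewrite -bT ffunE /= ltnS leqNgt ltn_neqAle eq_sym rj jr.
Qed.

Lemma path_sum (W : config k p -> CC R) (j : nat) : (j <= p.+1)%N ->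
  (forall i, (j <= i)%N -> tail_trivial i W) ->
  \sum_b path_weight U V p.+1 b * W b = \sum_b path_weight U V j b * W b.
Proof.
(* Induction on the number [p.+1 - j] of pairs already summed out. *)
move=> jp; rewrite -(subKn jp); move: (p.+1 - j)%N (leq_subr j p.+1) => n {j jp}.
elim: n => [|n IH] np tW; first by rewrite subn0.
rewrite IH ?(ltnW np) // => [|i ni]; last by apply: tW; apply: leq_trans ni; rewrite leq_sub2l.
have -> : (p.+1 - n = (p.+1 - n.+1).+1)%N by rewrite -subSn.
set j := (p.+1 - n.+1)%N.
have jp : (j <= p)%N by rewrite /j subSS leq_subr.
(* Group by truncation: where the weight is nonzero, [b] is mirrored from level j on, so [W] takes
   the value [W c] and leaves the inner sum. *)
rewrite (partition_big (trunc j) predT) //=; apply: eq_bigr => c _.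
rewrite -path_weight_fiber // mulr_suml; apply: eq_bigr => b /eqP bc.
have [bT|bT] := eqVneq (trunc j.+1 b) b; last by rewrite /path_weight (negbTE bT) !mul0r.
have [bj|bj] := eqVneq (b (true, inord j)) (b (false, inord j)); last first.
  by rewrite /path_weight (negbTE bj) mulr0 mulr0 !mul0r.
rewrite (tW j (leqnn j)) ?bc // => r; rewrite leq_eqVlt => /orP[/eqP jr|jr].
  by have <- : inord j = r by apply: val_inj; rewrite /= jr inord_val.
exact: (mirror_fix (leqnn _) bT).
Qed.
End PathSum.

(** * Sums against the weight [fweight] *)

Lemma fweight_path (R : realType) (k p : nat) (bet : 'rV[R]_p) : (1 < k)%N ->
  exists U V : nat -> 'Z_k -> 'Z_k -> CC R,
    (forall n a b, \sum_(c : 'Z_k) U n a c * V n c b = (a == b)%:R) /\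
    fweight bet =1 path_weight (k := k) U V p.+1.
Proof.
(* Padding the angles by 0 beyond p gives mixers for every natural index, all unitary. *)
move=> k1; pose beta n : R := if insub n is Some s then bet 0 s else 0.
exists (fun n a c => mixer (beta n) (a - c)), (fun n c b => mixer (- beta n) (c - b)).
split=> [n a b|b]; first exact: mixer_unitary.
have ordE n (np : (n < p.+1)%N) : Ordinal np = inord n by apply: val_inj; rewrite /= inordK.
rewrite /path_weight trunc_id // eqxx mul1r /fweight big_mkord.
have -> : inord p = ord_max :> 'I_p.+1 by apply: val_inj; rewrite /= inordK.
congr (_ * _); apply: eq_bigr => s _.
have -> : - 'i * ofR (bet 0 s) = 'i * ofR (- bet 0 s) by rewrite rmorphN mulrN mulNr.
rewrite !braket_expmx // /beta valK.
have e1 e : (e, widen_ord (leqnSn p) s) = (e, inord s) :> bool * 'I_p.+1.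
  by congr (_, _); apply: val_inj; rewrite /= inordK // ltnW // ltnS.
have e2 e : (e, lift ord0 s) = (e, inord s.+1) :> bool * 'I_p.+1.
  by congr (_, _); apply: val_inj; rewrite /= inordK // ltnS.
by rewrite /it /itS /iNt /iNtS !e1 !e2.
Qed.

(** Summing out the pairs beyond j leaves only configurations fixed by [trunc j], so agreement there
    is enough. *)
Lemma sum_fweight_congr (R : realType) (k p : nat) (bet : 'rV[R]_p) (j : nat)
    (W W' : config k p -> CC R) : (1 < k)%N ->
  (forall i, (j <= i)%N -> tail_trivial i W) ->
  (forall i, (j <= i)%N -> tail_trivial i W') ->
  (forall b, trunc j b = b -> W b = W' b) ->
  \sum_b fweight bet b * W b = \sum_b fweight bet b * W' b.
Proof.
move=> k1 tW tW' WW'; have [U [V [UV fE]]] := fweight_path bet k1.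
under eq_bigr do rewrite fE; under [RHS]eq_bigr do rewrite fE.
have [jp|pj] := leqP j p.+1; last first.
  by apply: eq_bigr => b _; rewrite WW' // trunc_id // ltnW.
rewrite (path_sum k1 UV jp tW) (path_sum k1 UV jp tW'); apply: eq_bigr => b _.
have [bT|bT] := eqVneq (trunc j b) b; first by rewrite WW'.
by rewrite /path_weight (negbTE bT) !mul0r.
Qed.

(** Summing out every pair leaves the zero configuration, whose remaining weight is an empty
    product. *)
Lemma sum_fweight (R : realType) (k p : nat) (bet : 'rV[R]_p)
    (W : config k p -> CC R) : (1 < k)%N -> (forall i, tail_trivial i W) ->
  \sum_b fweight bet b * W b = W 0.
Proof.
move=> k1 tW; have [U [V [UV fE]]] := fweight_path bet k1.
under eq_bigr do rewrite fE; rewrite (path_sum k1 UV (leq0n _) (fun i _ => tW i)).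
have t0 b : trunc 0 b = 0 :> config k p by apply/ffunP => t; rewrite !ffunE.
rewrite (bigD1 (0 : config k p)) //= big1 => [|b b0].
  by rewrite /path_weight t0 eqxx big_geq // !mul1r addr0.
by rewrite /path_weight t0 eq_sym (negbTE b0) !mul0r.
Qed.

(** * Phase cancellation and normalisation of [Hd] *)

Lemma GamN (R : realType) (p : nat) (gam : 'rV[R]_p) (r : 'I_p.+1) :
  Gam gam (false, r) = - Gam gam (true, r).
Proof. by rewrite /Gam /=; case: unlift; rewrite ?oppr0. Qed.

Lemma Phi_pairs (R : realType) (k p : nat) (phi : 'Z_k -> R) (gam : 'rV[R]_p)
    (c : config k p) :
  Phi phi gam c =
  \sum_(r < p.+1) Gam gam (true, r) * (phi (c (true, r)) - phi (c (false, r))).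
Proof.
rewrite /Phi (eq_bigr (fun t : Ip p => Gam gam (t.1, t.2) * phi (c (t.1, t.2))));
  last by case.
rewrite -(pair_bigA _ (fun e r => Gam gam (e, r) * phi (c (e, r)))) /=.
rewrite exchange_big /=; apply: eq_bigr => r _.
by rewrite big_bool GamN mulNr mulrBr.
Qed.

Lemma Phi_trunc (R : realType) (k p : nat) (phi : 'Z_k -> R) (gam : 'rV[R]_p)
    (j : nat) : tail_trivial j (Phi phi gam : config k p -> R).
Proof.
move=> c cj; rewrite !Phi_pairs; apply: eq_bigr => r _; rewrite !ffunE /=.
by case: ltnP => // jr; rewrite cj // !subrr.
Qed.

Lemma Phi_sub_trunc (R : realType) (k p : nat) (phi : 'Z_k -> R) (gam : 'rV[R]_p)
    (j : nat) (a b : config k p) : mirror j a -> mirror j b ->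
  Phi phi gam (a - b) = Phi phi gam (a - trunc j b).
Proof.
move=> aj bj; have tj : mirror j (trunc j b).
  exact: mirror_fix (trunc_trunc _ (leqnn j)).
rewrite (Phi_trunc phi gam (mirrorB aj bj)) (Phi_trunc phi gam (mirrorB aj tj)).
by rewrite !truncB trunc_trunc.
Qed.

(** Induction on m. Once the outer pairs of [b] are summed out, [b] vanishes beyond j, and the phase
    at [a - b] no longer sees the mirrored tail of [a]. *)
Lemma Hd_tail_trivial (R : realType) (k p : nat) (phi : 'Z_k -> R)
    (gam bet : 'rV[R]_p) (d m j : nat) : (1 < k)%N ->
  tail_trivial j (Hd phi gam bet d m : config k p -> CC R).
Proof.
move=> k1; elim: m j => [|m IH] j a aj //=; congr (_ ^+ d).
have tW a' i : (mirror i a') -> tail_trivial i (fun b => Hd phi gam bet d m b *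
    expC ('i * ofR (Phi phi gam (a' - b) / Num.sqrt d%:R))).
  move=> a'i b bi; rewrite (IH i b bi).
  by rewrite (Phi_sub_trunc phi gam a'i bi).
under eq_bigr do rewrite -mulrA; under [RHS]eq_bigr do rewrite -mulrA.
have ta : trunc j (trunc j a) = trunc j a by rewrite trunc_trunc.
apply: (@sum_fweight_congr _ _ _ bet j) => // [i ji|i ji|b bj].
- by apply: tW; exact: mirror_le aj.
- by apply: tW; exact: mirror_fix ta.
have mb : mirror j b by exact: mirror_fix bj.
by rewrite (Phi_trunc phi gam (mirrorB aj mb)) truncB bj.
Qed.

Lemma Phi0 (R : realType) (k p : nat) (phi : 'Z_k -> R) (gam : 'rV[R]_p) :
  Phi phi gam (0 : config k p) = 0.
Proof. by rewrite Phi_pairs big1 // => r _; rewrite !ffunE subrr mulr0. Qed.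

(** At a = 0 the summand is tail-trivial at every level, so its sum is its value at b = 0, where the
    phase is 0. *)
Lemma Hd_0 (R : realType) (k p : nat) (phi : 'Z_k -> R)
    (gam bet : 'rV[R]_p) (d m : nat) : (1 < k)%N ->
  Hd phi gam bet d m (0 : config k p) = 1.
Proof.
move=> k1; elim: m => //= m IH.
under eq_bigr do rewrite -mulrA.
rewrite sum_fweight // => [|i b bi].
  by rewrite IH subrr Phi0 mul0r rmorph0 mulr0 expC0 mul1r expr1n.
have m0 : mirror i (0 : config k p) by move=> r _; rewrite !ffunE.
by rewrite (Hd_tail_trivial _ _ _ _ _ k1 bi) (Phi_sub_trunc phi gam m0 bi).
Qed.

Lemma sum_fweight_Hd (R : realType) (k p : nat) (phi : 'Z_k -> R)
    (gam bet : 'rV[R]_p) (d m : nat) : (1 < k)%N ->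
  \sum_(b : config k p) fweight bet b * Hd phi gam bet d m b = 1.
Proof.
move=> k1; rewrite sum_fweight ?Hd_0 // => i; exact: Hd_tail_trivial.
Qed.

(** * Translation invariance and the vanishing first-order term *)

Definition shift (k p : nat) (s : 'Z_k) (b : config k p) : config k p :=
  [ffun t => b t + s].

Lemma addrDs (V : zmodType) (x y s : V) : x + s - (y + s) = x - y.
Proof. by rewrite opprD addrACA subrr addr0. Qed.

Lemma fweight_shift (R : realType) (k p : nat) (bet : 'rV[R]_p) (s : 'Z_k)
    (b : config k p) : (1 < k)%N -> fweight bet (shift s b) = fweight bet b.
Proof.
move=> k1; rewrite /fweight !ffunE (inj_eq (addIr s)); congr (_ * _).
apply: eq_bigr => t _.
have -> : - 'i * ofR (bet 0 t) = 'i * ofR (- bet 0 t) by rewrite rmorphN mulrN mulNr.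
by rewrite !braket_expmx // !ffunE !addrDs.
Qed.

Lemma big_shift (R : nmodType) (k p : nat) (s : 'Z_k) (F : config k p -> R) :
  \sum_b F b = \sum_b F (shift s b).
Proof.
rewrite (reindex_inj (h := shift s)) // => a b /ffunP ab; apply/ffunP => t.
by have := ab t; rewrite !ffunE => /addIr.
Qed.

Lemma Hd_shift (R : realType) (k p : nat) (phi : 'Z_k -> R)
    (gam bet : 'rV[R]_p) (d m : nat) (s : 'Z_k) (a : config k p) : (1 < k)%N ->
  Hd phi gam bet d m (shift s a) = Hd phi gam bet d m a.
Proof.
move=> k1; elim: m a => //= m IH a; rewrite (big_shift s); congr (_ ^+ d).
apply: eq_bigr => b _; rewrite IH fweight_shift //.
have -> // : shift s a - shift s b = a - b.
by apply/ffunP => t; rewrite !ffunE addrDs.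
Qed.

Lemma sum_fweight_Hd_Phi (R : realType) (k p : nat) (phi : 'Z_k -> R)
    (gam bet : 'rV[R]_p) (d m : nat) (a : config k p) : (1 < k)%N ->
  \sum_x phi x = 0 ->
  \sum_b fweight bet b * Hd phi gam bet d m b * ofR (Phi phi gam (a - b)) = 0.
Proof.
move=> k1 phi0; pose g b := fweight bet b * Hd phi gam bet d m b.
have sum0 t : \sum_b g b * ofR (phi ((a - b) t)) = 0.
  set S := \sum_b _.
  (* Average over all k translations of [b]: the weights are unchanged while [phi] runs over all its
     values, which sum to 0. *)
  have kS : S *+ k = 0.
    rewrite -[X in S *+ X](card_Zk k1) -sumr_const.
    transitivity (\sum_(s : 'Z_k) \sum_b g b * ofR (phi ((a - b) t - s))).
      apply: eq_bigr => s _; rewrite /S (big_shift s); apply: eq_bigr => b _.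
      by rewrite /g fweight_shift // Hd_shift // !ffunE opprD addrA.
    rewrite exchange_big big1 // => b _; rewrite -mulr_sumr -rmorph_sum /=.
    have -> : \sum_(s : 'Z_k) phi ((a - b) t - s) = \sum_s phi s.
      rewrite [RHS](reindex_inj (h := fun s => (a - b) t - s)) //.
      by move=> x y /addrI/oppr_inj.
    by rewrite phi0 rmorph0 mulr0.
  by apply/eqP; move/eqP: kS; rewrite mulrn_eq0 => /orP[/eqP k0|//]; rewrite k0 in k1.
under eq_bigr => b _ do rewrite rmorph_sum mulr_sumr.
rewrite exchange_big big1 // => t _.
under eq_bigr do rewrite rmorphM mulrCA.
by rewrite -mulr_sumr sum0 mulr0.
Qed.

(** * Roots of unity and Fourier inversion on ['Z_k] *)

Lemma omegaX (R : realType) (k n : nat) :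
  omega R k ^+ n = expC ('i * ofR (2 * pi * n%:R / k%:R)).
Proof.
rewrite /omega -expCMn; congr expC.
rewrite fmorph_div !rmorphM /= !rmorph_nat -mulr_natr; ring.
Qed.

Lemma omegaXk (R : realType) (k : nat) : (1 < k)%N -> omega R k ^+ k = 1.
Proof.
move=> k1; have k0 : k%:R != 0 :> R by rewrite pnatr_eq0 -lt0n ltnW.
have pi2 : 2 * pi * k%:R / k%:R = pi *+ 2 :> R by rewrite mulfK // mulr_natl.
by rewrite omegaX pi2 expCi cos2pi sin2pi rmorph1 rmorph0 mulr0 addr0.
Qed.

(** If the power were 1, its cosine would be 1 and the sine of the half angle pi n / k would vanish,
    although that angle lies strictly between 0 and pi. *)
Lemma omegaX_neq1 (R : realType) (k n : nat) : (0 < n < k)%N ->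
  omega R k ^+ n != 1.
Proof.
case/andP=> n0 nk; have k0 : 0 < k%:R :> R by rewrite ltr0n (leq_trans _ nk).
rewrite omegaX expCi; apply/eqP => e1.
have := cRe_rect (cos (2 * pi * n%:R / k%:R)) (sin (2 * pi * n%:R / k%:R) : R).
rewrite e1 [LHS]/= => c1; have := one_sub_cos (2 * pi * n%:R / k%:R : R).
rewrite -c1 subrr => /esym/eqP; rewrite mulf_eq0 sqrf_eq0 pnatr_eq0 /=.
apply/negP; rewrite gt_eqF //; apply: sin_gt0_pi.
have -> : 2 * pi * n%:R / k%:R / 2 = pi * (n%:R / k%:R) :> R by field; rewrite gt_eqF.
rewrite mulr_gt0 ?pi_gt0 ?divr_gt0 // ?ltr0n //=.
by rewrite gtr_pMr ?pi_gt0 // ltr_pdivrMr // mul1r ltr_nat.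
Qed.

Lemma omega_unit (R : realType) (k : nat) : (omega R k)^* * omega R k = 1.
Proof.
rewrite mulrC -normCK -[omega R k]expr1 omegaX norm_expC.
have := cRe_rect (0 : R) (2 * pi * 1%:R / k%:R); rewrite rmorph0 add0r => ->.
by rewrite expR0 rmorph1 expr1n.
Qed.

Lemma omegaD (R : realType) (k : nat) (x y : 'Z_k) : (1 < k)%N ->
  omega R k ^+ (x + y)%R = omega R k ^+ x * omega R k ^+ y.
Proof.
move=> k1; rewrite -exprD /= -[in RHS](expr_mod _ (omegaXk R k1)).
by rewrite {3}Zp_cast.
Qed.

Lemma omegaB (R : realType) (k : nat) (x y : 'Z_k) : (1 < k)%N ->
  omega R k ^+ (x - y)%R = omega R k ^+ x * (omega R k)^* ^+ y.
Proof.
move=> k1; have -> : omega R k ^+ x = omega R k ^+ (x - y)%R * omega R k ^+ y.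
  by rewrite -omegaD // subrK.
by rewrite -mulrA [_ ^+ y * _]mulrC -exprMn omega_unit expr1n mulr1.
Qed.

Lemma sum_omega (R : realType) (k : nat) (z : 'Z_k) : (1 < k)%N ->
  \sum_(xi : 'Z_k) omega R k ^+ (xi * z)%R = (z == 0)%:R * k%:R.
Proof.
move=> k1; have [->|z0] := eqVneq z 0.
  under eq_bigr do rewrite mulr0 expr0.
  by rewrite sumr_const card_Zk // mul1r.
set S := \sum_xi _; rewrite mul0r.
(* Translating the summation index by 1 multiplies the sum by [omega R k ^+ z], which differs from 1
   for z nonzero. *)
have SE : S = S * omega R k ^+ z.
  rewrite {1}/S (reindex_inj (addIr (1 : 'Z_k))) mulr_suml; apply: eq_bigr => xi _.
  by rewrite mulrDl mul1r omegaD.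
apply/eqP; have /eqP := SE; rewrite -subr_eq0 -{1}[S]mulr1 -mulrBr mulf_eq0.
case/orP => // /eqP/eqP; rewrite subr_eq0 eq_sym.
rewrite (negbTE (omegaX_neq1 R (k := k) (n := z) _)) //.
rewrite lt0n -[X in _ && (_ < X)%N](Zp_cast k1) ltn_ord andbT.
by apply: contra z0 => /eqP z0; apply/eqP/val_inj.
Qed.

Lemma dft_inversion (R : realType) (k : nat) (phi : 'Z_k -> R) (x : 'Z_k) :
  (1 < k)%N ->
  ofR (phi x) = \sum_(xi : 'Z_k) dft phi xi / k%:R * omega R k ^+ (xi * x)%R.
Proof.
move=> k1; have k0 : k%:R != 0 :> CC R by rewrite pnatr_eq0 -lt0n ltnW.
have E (y : 'Z_k) : \sum_(xi : 'Z_k) ofR (phi y) / k%:R * omega R k ^+ (xi * (x - y))%R =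
    (y == x)%:R * ofR (phi y).
  by rewrite -mulr_sumr sum_omega // subr_eq0 eq_sym mulrCA divfK.
transitivity (\sum_(y : 'Z_k) (y == x)%:R * ofR (phi y)).
  by rewrite (bigD1 x) //= eqxx mul1r big1 ?addr0 // => y /negbTE ->; rewrite mul0r.
rewrite -(eq_bigr _ (fun y _ => E y)) exchange_big; apply: eq_bigr => xi _.
rewrite /dft !mulr_suml; apply: eq_bigr => y _.
by rewrite mulrBr omegaB //; ring.
Qed.

(** Expand both factors of Phi(a - b)^2 by Fourier inversion; each character splits into a part in
    [a] and a part in [b], and the [b] parts summed against f H are the entries of G. *)
Lemma Hlim_exponent (R : realType) (k p : nat) (phi : 'Z_k -> R)
    (gam bet : 'rV[R]_p) (H : config k p -> CC R) (a : config k p) :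
  (1 < k)%N ->
  \sum_(xi : 'Z_k) \sum_(eta : 'Z_k) \sum_(t : Ip p) \sum_(u : Ip p)
    Gcorr bet H xi t eta u * ofR (Gam gam t) * ofR (Gam gam u) *
    (dft phi xi * dft phi eta / k%:R ^+ 2) *
    omega R k ^+ (xi * a t)%R * omega R k ^+ (eta * a u)%R =
  \sum_b fweight bet b * H b * ofR (Phi phi gam (a - b)) ^+ 2.
Proof.
move=> k1; pose c (b : config k p) xi t := ofR (Gam gam t) * (dft phi xi / k%:R) *
  (omega R k ^+ (xi * a t)%R * (omega R k)^* ^+ (xi * b t)%R).
have PhiE b : ofR (Phi phi gam (a - b)) = \sum_(xi : 'Z_k) \sum_(t : Ip p) c b xi t.
  rewrite exchange_big rmorph_sum; apply: eq_bigr => t _ /=.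
  rewrite rmorphM /= !ffunE dft_inversion // mulr_sumr; apply: eq_bigr => xi _.
  by rewrite mulrBr omegaB // /c; ring.
transitivity (\sum_(b : config k p) \sum_(xi : 'Z_k) \sum_(eta : 'Z_k)
    \sum_(t : Ip p) \sum_(u : Ip p)
    fweight bet b * H b * (c b xi t * c b eta u)); last first.
  apply: eq_bigr => b _; rewrite PhiE expr2 big_distrlr mulr_sumr.
  apply: eq_bigr => xi _; rewrite mulr_sumr; apply: eq_bigr => eta _.
  rewrite big_distrlr mulr_sumr; apply: eq_bigr => t _.
  by rewrite mulr_sumr.
rewrite [RHS]exchange_big; apply: eq_bigr => xi _.
rewrite [RHS]exchange_big; apply: eq_bigr => eta _.
rewrite [RHS]exchange_big; apply: eq_bigr => t _.
rewrite [RHS]exchange_big; apply: eq_bigr => u _.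
rewrite /Gcorr 5!mulr_suml; apply: eq_bigr => b _.
have k0 : k%:R != 0 :> CC R by rewrite pnatr_eq0 -lt0n ltnW.
by rewrite /c; field.
Qed.

(** * The limit of the recursion *)

Lemma cvg_sum_fin (F : numFieldType) (I : finType) (u : nat -> I -> F) (l : I -> F) :
  (forall i, (fun n => u n i) @ \oo --> l i) ->
  (fun n => \sum_i u n i) @ \oo --> \sum_i l i.
Proof. by move=> ul; apply: cvg_big => [|i _]; [exact: add_continuous|exact: ul]. Qed.

Theorem proposition5 (R : realType) (k p : nat) (hk : (2 <= k)%N) (hp : (1 <= p)%N)
    (phi : 'Z_k -> R) (phi_even : forall x : 'Z_k, phi (- x) = phi x)
    (phi_sum0 : \sum_(x : 'Z_k) phi x = 0)
    (gam bet : 'rV[R]_p) (m : nat) (hm : (m <= p)%N) (a : config k p) :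
  (fun d : nat => Hd phi gam bet d m a) @ \oo --> Hlim phi gam bet m a.
Proof.
clear hm; elim: m a => [|m IH] a; first exact: cvg_cst.
(* The d-th power is handled by its base: it remains to find the limit of d times (base - 1). *)
apply: cvg_exprn_expC; rewrite Hlim_exponent //.
pose rem (n : nat) b : CC R := n%:R * (expC ('i * ofR (Phi phi gam (a - b) / Num.sqrt n%:R))
  - 1 - 'i * ofR (Phi phi gam (a - b) / Num.sqrt n%:R)).
have -> : - 2^-1 * (\sum_b fweight bet b * Hlim phi gam bet m b *
      ofR (Phi phi gam (a - b)) ^+ 2) =
    \sum_b fweight bet b * Hlim phi gam bet m b * ofR (- 2^-1 * Phi phi gam (a - b) ^+ 2).
  rewrite mulr_sumr; apply: eq_bigr => b _.
  by rewrite rmorphM rmorphN fmorphV rmorph_nat rmorphXn mulrCA.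
(* Exact for every n: the zeroth- and first-order terms are removed by the two identities for [Hd]
   at that same n, before any limit is taken. *)
have step n : n%:R * (\sum_b fweight bet b * Hd phi gam bet n m b *
      expC ('i * ofR (Phi phi gam (a - b) / Num.sqrt n%:R)) - 1) =
    \sum_b fweight bet b * Hd phi gam bet n m b * rem n b.
  have s0 := sum_fweight_Hd_Phi gam bet n m a hk phi_sum0.
  have s1 := sum_fweight_Hd phi gam bet n m hk.
  transitivity (n%:R * (\sum_b fweight bet b * Hd phi gam bet n m b *
      expC ('i * ofR (Phi phi gam (a - b) / Num.sqrt n%:R)) -
      \sum_b fweight bet b * Hd phi gam bet n m b -
      'i / ofR (Num.sqrt n%:R) *
      \sum_b fweight bet b * Hd phi gam bet n m b * ofR (Phi phi gam (a - b)))).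
    by rewrite s0 s1 mulr0 subr0.
  rewrite mulr_sumr -!sumrB mulr_sumr; apply: eq_bigr => b _.
  rewrite /rem fmorph_div; ring.
rewrite (_ : (fun n : nat => _) = (fun n =>
  \sum_b fweight bet b * Hd phi gam bet n m b * rem n b)); last exact/funext.
apply: cvg_sum_fin => b; apply: cvgM; last exact: cvg_expCi_remainder.
by apply: cvgM; [exact: cvg_cst|exact: IH].
Qed.
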